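(* Let $G$ be a graph on $n$ vertices containing a hamilton circuit $H_C$, and let $H_0$ be a pseudo-hamilton circuit each of whose edges lies in $K_n - G$. Then there always exists a finite sequence of permutations $s_0, s_1, \ldots, s_{r-1}$ such that, with $H_{i+1} = H_i s_i$ for $0 \le i < r$, each $s_i$ is an $H_i$-admissible permutation and $H_r = H_C$.
   Context: $V=\{1,\dots,n\}$ is the vertex set of $G$, and $K_n$ is the complete graph on $V$. Permutations in $S_n$ are multiplied so that $(hs)(x) = h(s(x))$. An $n$-cycle $h\in S_n$ is identified with the directed cycle $H$ in $K_n$ whose arcs are $(x,h(x))$, $x\in V$, and one writes $H(x)=h(x)$; such an $H$ is called a pseudo-hamilton circuit of $G$, and $Hs$ denotes the object corresponding to $hs$. A hamilton circuit $H_C$ is a pseudo-hamilton circuit all of whose arcs come from edges of $G$ (with one of its two orientations chosen). An arc $(x,H(x))$ of $H$ is a pseudo-arc if $\{x,H(x)\}$ is not an edge of $G$, and then $x$ is a pseudo-arc vertex; otherwise $x$ is an arc vertex. A permutation $s$ is $H$-admissible if $hs$ is again an $n$-cycle and $Hs$ contains at least as many arcs in $G$ as $H$ does. In this result the admissible permutations are each either a 3-cycle or a product of two disjoint 2-cycles. *)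

(* Defs.v *)
From mathcomp Require Import all_boot all_fingroup.

Set Implicit Arguments.
Unset Strict Implicit.
Unset Printing Implicit Defensive.

Record sgraph (n : nat) := SGraph {
  edge :> rel 'I_n;
  edge_sym : symmetric edge;
  edge_irr : irreflexive edge }.

(* MathComp composes permutations left to right, (s * h) x = h (s x); here
   (hs)(x) = h(s(x)). *)
Definition rcomp (n : nat) (h s : 'S_n) : 'S_n := (s * h)%g.

Definition cycle_on (n : nat) (A : {set 'I_n}) (s : 'S_n) : Prop :=
  perm_on A s /\ forall x, x \in A -> porbit s x = A.

Definition kcycle (n k : nat) (s : 'S_n) : Prop :=
  exists2 A : {set 'I_n}, #|A| = k & cycle_on A s.

Definition two_disjoint_2cycles (n : nat) (s : 'S_n) : Prop :=
  exists (A B : {set 'I_n}) (u v : 'S_n),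
    [/\ #|A| = 2, #|B| = 2, [disjoint A & B],
        cycle_on A u /\ cycle_on B v & s = rcomp u v].

(* The directed cycle with arcs (x, h x) is represented by h itself. *)
Definition pseudo_hamilton_circuit (n : nat) (h : 'S_n) : Prop := kcycle n h.

Definition pseudo_arc_vertex (n : nat) (G : sgraph n) (h : 'S_n) (x : 'I_n)
  : bool := ~~ G x (h x).

Definition arc_vertex (n : nat) (G : sgraph n) (h : 'S_n) (x : 'I_n)
  : bool := G x (h x).

(* A choice of one of the two orientations is part of h. *)
Definition hamilton_circuit (n : nat) (G : sgraph n) (h : 'S_n) : Prop :=
  pseudo_hamilton_circuit h /\ forall x, arc_vertex G h x.

Definition num_arcs (n : nat) (G : sgraph n) (h : 'S_n) : nat :=
  #|[set x | arc_vertex G h x]|.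

Definition admissible (n : nat) (G : sgraph n) (h s : 'S_n) : Prop :=
  pseudo_hamilton_circuit (rcomp h s) /\
  num_arcs G h <= num_arcs G (rcomp h s).

(* Main.v *)
Require Import Defs.
From mathcomp Require Import all_boot all_fingroup zify.

(** Let c be the target circuit and h the current one.  Exchanging the heads of
the arcs at u and v replaces h by [swap u v h]; two such exchanges, applied one
after the other, compose h with a 3-cycle or with a product of two disjoint
2-cycles.  Everything is read off the permutation c^-1 h ([mismatch c h]): it
fixes exactly the vertices at which h agrees with c, it changes by the same
exchange as h does, and, whenever y is moved and x is the image of y, the
exchange of x and y gives x its arc of c.

An exchange of u and v splits the cycle of h into two, so a second exchange has
to join two vertices on different sides.  As c is a single cycle, some arc of c
leaves one side for the other ([crossing_vertex]), hence some cycle of the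
mismatch meets both sides, and the second exchange can be made inside that
cycle.  If both exchanges are made inside cycles of the mismatch, no agreement
with c is lost and the first one creates a new agreement, so that the process
stops at c.

The difficulty is that h may acquire arcs of G that do not belong to c, and that
these must be given up later without lowering the number of arcs in G.  Call two
vertices a clash if they are distinct, lie in the same cycle of the mismatch and
both carry an arc of G (such arcs are then not arcs of c).  The invariant is that
there is at most one clash; a circuit without arcs in G has none.  Giving x its
arc of c can only lower the number of arcs in G if x and y clash.  Therefore:

- the first exchange can be chosen so that either no clash remains and no arc of
  G is lost, or at most one clash remains and an arc of G is gained
  ([first_swap]);
- if no clash remains, the second exchange gives a vertex x its arc of c across
  the two sides; it loses no arc of G and creates at most one clash
  ([second_swap_free]);
- if one clash remains, the arc just gained pays for a second exchange that loses
  at most one arc of G and keeps the invariant ([second_swap]).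

The invariant survives because an exchange inside a cycle of the mismatch splits
that cycle with u and v in different parts: every new clash joins u or v to one
of the other vertices of the old cycle that carried an arc of G ([clash_swap]). *)

Set Implicit Arguments.
Unset Strict Implicit.
Unset Printing Implicit Defensive.

(** * Cycles of a permutation and transpositions *)

Lemma porbit_step (T : finType) (s : {perm T}) x : porbit s (s x) = porbit s x.
Proof. exact: (porbit_perm s 1). Qed.

Lemma porbit_fixed (T : finType) (s : {perm T}) x y :
  s x = x -> porbit s y = porbit s x -> y = x.
Proof.
move=> sx /eqP; rewrite eq_porbit_mem => /porbitP[i ->].
by elim: i => [|i IHi]; rewrite ?expg0 ?perm1 // expgSr permM IHi sx.
Qed.

Lemma porbit_moved (T : finType) (s : {perm T}) x y :
  porbit s y = porbit s x -> s y != y -> s x != x.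
Proof. by move=> oxy; apply: contraNneq => /[dup] sx /porbit_fixed/(_ oxy) ->; rewrite sx. Qed.

Lemma porbit_coarsen (T : finType) (s r : {perm T}) :
    (forall w, porbit s (r w) = porbit s w) ->
  forall x y, porbit r x = porbit r y -> porbit s x = porbit s y.
Proof.
move=> rs x y /eqP; rewrite eq_porbit_mem => /porbitP[i ->].
by elim: i => [|i IHi]; rewrite ?expg0 ?perm1 // expgSr permM rs.
Qed.

Lemma porbits_split (T : finType) (s : {perm T}) u v :
    u != v -> porbit s u = porbit s v ->
  #|porbits (tperm u v * s)| = #|porbits s|.+1.
Proof.
move=> uv /eqP; rewrite eq_porbit_mem => us.
by have /= := porbits_mul_tperm s u v; rewrite us uv /= addn0 addn1.
Qed.

Lemma porbits_merge (T : finType) (s : {perm T}) u v :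
  porbit s u != porbit s v -> #|porbits s| = #|porbits (tperm u v * s)|.+1.
Proof.
rewrite eq_porbit_mem => us.
have uv : u != v by apply: contraNneq us => ->; rewrite porbit_id.
have /= := porbits_mul_tperm s u v; rewrite us uv /=; lia.
Qed.

(** If u and v still shared a cycle after the exchange, exchanging them twice
would raise the number of cycles by two and yet give back s. *)
Lemma swap_separates (T : finType) (s : {perm T}) u v :
    u != v -> porbit s u = porbit s v ->
  porbit (tperm u v * s) u != porbit (tperm u v * s) v.
Proof.
move=> uv us; apply/eqP=> us'; have := porbits_split uv us'.
by rewrite mulgA tperm2 mul1g (porbits_split uv us); lia.
Qed.

Lemma swap_refines (T : finType) (s : {perm T}) u v a b :
    porbit s u = porbit s v ->
  porbit (tperm u v * s) a = porbit (tperm u v * s) b ->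
  porbit s a = porbit s b.
Proof.
move=> us; apply: porbit_coarsen => w; rewrite permM porbit_step.
by case: tpermP => [->|->|].
Qed.

Lemma pseudo_hamiltonP n (h : 'S_n) :
  pseudo_hamilton_circuit h <-> forall x y, porbit h x = porbit h y.
Proof.
split=> [[A cA [_ hA]] x y | hP].
  have AT : A = setT by apply/eqP; rewrite eqEcard subsetT cardsT card_ord cA /=.
  by rewrite !hA // AT inE.
exists setT; first by rewrite cardsT card_ord.
split=> [|x _]; first by apply/subsetP=> x; rewrite inE.
by apply/setP=> y; rewrite -eq_porbit_mem (hP y x) eqxx inE.
Qed.

Lemma hamilton_card n (h : 'S_n) (x0 : 'I_n) :
  pseudo_hamilton_circuit h <-> #|porbits h| = 1.
Proof.
rewrite pseudo_hamiltonP; split=> [hP | /eqP/cards1P[A hA] x y].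
  apply/eqP/cards1P; exists (porbit h x0); apply/setP=> A; rewrite inE.
  by apply/imsetP/eqP => [[x _ ->]|->]; [exact: hP | exists x0].
have oA z : porbit h z = A by apply/eqP; rewrite -in_set1 -hA imset_f.
by rewrite !oA.
Qed.

(** * Products of two transpositions *)

Lemma cycle_onI n (A : {set 'I_n}) (s : 'S_n) a :
    perm_on A s -> a \in A -> (forall x, x \in A -> exists i, x = (s ^+ i)%g a) ->
  cycle_on A s.
Proof.
move=> sA aA reach; split=> // x xA; have [i ->] := reach x xA.
rewrite porbit_perm; apply/setP=> y; apply/porbitP/idP=> [[j ->]|/reach//].
by elim: j => [|j IHj]; rewrite ?expg0 ?perm1 // expgSr permM (perm_closed _ sA).
Qed.

Lemma cycle_on_tperm n (u v : 'I_n) : cycle_on [set u; v] (tperm u v).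
Proof.
apply: (@cycle_onI _ _ _ u); rewrite ?set21 //.
  by apply/subsetP=> x; rewrite !inE; case: tpermP => [->|->|]; rewrite ?eqxx ?orbT.
move=> x /set2P[]->; first by exists 0; rewrite expg0 perm1.
by exists 1; rewrite expg1 tpermL.
Qed.

Lemma kcycle3_tpermM n (a b c : 'I_n) :
  a != b -> a != c -> b != c -> kcycle 3 (tperm a b * tperm a c)%g.
Proof.
move=> ab ac bc; set s := (_ * _)%g.
have sa : s a = b by rewrite permM tpermL tpermD // eq_sym.
have sb : s b = c by rewrite permM tpermR tpermL.
exists (a |: [set b; c]).
  by rewrite cardsU1 cards2 !inE negb_or ab ac bc.
apply: (@cycle_onI _ _ _ a); rewrite ?setU11 //.
  apply/subsetP=> x; rewrite !inE permM; apply: contraNT.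
  rewrite !negb_or => /and3P[xa xb xc].
  by rewrite !tpermD // eq_sym.
move=> x /setU1P[->|/set2P[]->]; first by exists 0; rewrite expg0 perm1.
  by exists 1; rewrite expg1 sa.
by exists 2; rewrite expgS expg1 permM sa sb.
Qed.

(** The hypothesis that x is off the other transposition excludes the identity. *)
Lemma tpermM_shape n (u v x y : 'I_n) :
    u != v -> x != y -> x != u -> x != v ->
  kcycle 3 (tperm u v * tperm x y)%g \/
  two_disjoint_2cycles (tperm u v * tperm x y)%g.
Proof.
move=> uv xy xu xv.
have [->|yu] := eqVneq y u.
  by left; rewrite (tpermC x); apply: kcycle3_tpermM; rewrite // eq_sym.
have [->|yv] := eqVneq y v.
  by left; rewrite (tpermC u) (tpermC x); apply: kcycle3_tpermM; rewrite // eq_sym.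
right; exists [set x; y], [set u; v], (tperm x y), (tperm u v).
split=> //; rewrite ?cards2 ?uv ?xy //; last by split; apply: cycle_on_tperm.
by rewrite disjoints_subset; apply/subsetP=> z /set2P[]->; rewrite !inE negb_or ?xu ?yu.
Qed.

(** * Exchanges of heads, mismatches and clashes *)

(** In the convention (hs)(x) = h(s(x)) this is h (u v): the arcs at u and v
exchange their heads. *)
Definition swap n (u v : 'I_n) (h : 'S_n) : 'S_n := (tperm u v * h)%g.

(** This is c^-1 h: it maps y to the vertex whose arc in c has the head of the arc
of h at y. *)
Definition mismatch n (c h : 'S_n) : 'S_n := (h * c^-1)%g.

Definition clash n (G : sgraph n) (c h : 'S_n) (a b : 'I_n) : Prop :=
  [/\ a != b, porbit (mismatch c h) a = porbit (mismatch c h) b,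
      arc_vertex G h a & arc_vertex G h b].

Definition clash_free n (G : sgraph n) (c h : 'S_n) : Prop :=
  forall a b, ~ clash G c h a b.

(** A clash is symmetric, so that asking for one end only already forces
{a, b} = {p, q}. *)
Definition at_most_one_clash n (G : sgraph n) (c h : 'S_n) : Prop :=
  forall p q a b, clash G c h p q -> clash G c h a b -> a \in [:: p; q].

Lemma swapL n (u v : 'I_n) h : swap u v h u = h v.
Proof. by rewrite permM tpermL. Qed.

Lemma swapR n (u v : 'I_n) h : swap u v h v = h u.
Proof. by rewrite permM tpermR. Qed.

Lemma swap_id n (u v : 'I_n) h x : x \notin [:: u; v] -> swap u v h x = h x.
Proof. by rewrite !inE negb_or => /andP[xu xv]; rewrite permM tpermD // eq_sym. Qed.

Lemma mismatchE n (c h : 'S_n) x : c (mismatch c h x) = h x.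
Proof. by rewrite permM permKV. Qed.

Lemma mismatch_fixed n (c h : 'S_n) x : (mismatch c h x == x) = (h x == c x).
Proof. by rewrite -(mismatchE c h x) (inj_eq perm_inj). Qed.

Lemma mismatch_swap n (c h : 'S_n) u v :
  mismatch c (swap u v h) = swap u v (mismatch c h).
Proof. by rewrite /mismatch /swap mulgA. Qed.

Lemma clash_sym n (G : sgraph n) c h a b : clash G c h a b -> clash G c h b a.
Proof. by case=> ab oab Ga Gb; split; rewrite // eq_sym. Qed.

Lemma at_most_one_clashP n (G : sgraph n) c h p q a b :
    at_most_one_clash G c h -> clash G c h p q -> clash G c h a b ->
  a = p /\ b = q \/ a = q /\ b = p.
Proof.
move=> one pq ab; have := one _ _ _ _ pq ab; have := one _ _ _ _ pq (clash_sym ab).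
case: ab => /eqP ab _ _ _; rewrite !inE => /orP[]/eqP bE /orP[]/eqP aE.
- by case: ab; rewrite aE bE.
- by right.
- by left.
- by case: ab; rewrite aE bE.
Qed.

Lemma clash_free_one n (G : sgraph n) c h : clash_free G c h -> at_most_one_clash G c h.
Proof. by move=> free p q a b pq; case: (free p q pq). Qed.

(** The exchange refines the cycles of the mismatch and separates u from v, and it
leaves the arcs at all other vertices alone; hence a clash that is not old has
exactly one end in {u, v}, and its other end already carried an arc of G. *)
Lemma clash_swap n (G : sgraph n) (c h : 'S_n) u v a b :
    porbit (mismatch c h) u = porbit (mismatch c h) v -> u != v ->
    clash G c (swap u v h) a b ->
  [\/ [/\ clash G c h a b, a \notin [:: u; v] & b \notin [:: u; v]],
      [/\ a \in [:: u; v], b \notin [:: u; v],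
          porbit (mismatch c h) b = porbit (mismatch c h) u & arc_vertex G h b]
    | [/\ b \in [:: u; v], a \notin [:: u; v],
          porbit (mismatch c h) a = porbit (mismatch c h) u & arc_vertex G h a]].
Proof.
move=> uv neq [ab oab' Ga Gb].
have sep := swap_separates neq uv.
have oab : porbit (mismatch c h) a = porbit (mismatch c h) b.
  by apply: (swap_refines uv); rewrite mismatch_swap in oab'.
rewrite mismatch_swap in oab'.
have [au|au] := boolP (a \in [:: u; v]); have [bu|bu] := boolP (b \in [:: u; v]).
- case/negP: sep; move: au bu ab oab'; rewrite !inE.
  by move=> /orP[]/eqP-> /orP[]/eqP->; rewrite ?eqxx // => _ ->.
- constructor 2; split=> //; last by rewrite /arc_vertex swap_id in Gb.
  by rewrite -oab; move: au; rewrite !inE => /orP[]/eqP->.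
- constructor 3; split=> //; last by rewrite /arc_vertex swap_id in Ga.
  by rewrite oab; move: bu; rewrite !inE => /orP[]/eqP->.
rewrite /arc_vertex swap_id // in Ga; rewrite /arc_vertex swap_id // in Gb.
by constructor 1.
Qed.

Lemma clash_swap_old n (G : sgraph n) (c h : 'S_n) u v :
    porbit (mismatch c h) u = porbit (mismatch c h) v -> u != v ->
    (forall w, w \notin [:: u; v] ->
       porbit (mismatch c h) w = porbit (mismatch c h) u -> ~~ arc_vertex G h w) ->
  forall a b, clash G c (swap u v h) a b ->
  [/\ clash G c h a b, a \notin [:: u; v] & b \notin [:: u; v]].
Proof.
move=> uv neq none a b /(clash_swap uv neq)[//|[_ bu bo Gb]|[_ au ao Ga]].
  by rewrite (negPf (none _ bu bo)) in Gb.
by rewrite (negPf (none _ au ao)) in Ga.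
Qed.

(** If some third vertex w of the cycle carries an arc of G, then u and w form the
only clash of h, so w is the only possible other end of a new clash; since u and
v are separated, w is in a cycle with just one of them. *)
Lemma at_most_one_clash_swap n (G : sgraph n) (c h : 'S_n) u v :
    porbit (mismatch c h) u = porbit (mismatch c h) v -> u != v ->
    arc_vertex G h u -> at_most_one_clash G c h -> at_most_one_clash G c (swap u v h).
Proof.
move=> uv neq Gu one p q a b.
have meet x y z : clash G c h u z -> clash G c h x y -> u = x \/ u = y.
  by move=> uz xy; case: (at_most_one_clashP one xy uz) => -[]; auto.
have old_or_new x y : clash G c (swap u v h) x y ->
    [/\ clash G c h x y, x \notin [:: u; v] & y \notin [:: u; v]] \/
    exists2 w, clash G c h u w &
      x \in [:: u; v] /\ y = w \/ y \in [:: u; v] /\ x = w.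
  case/(clash_swap uv neq)=> [|[xu yu oy Gy]|[yu xu ox Gx]]; first by left.
    by right; exists y; [split=> //; case/norP: yu; rewrite eq_sym | left].
  by right; exists x; [split=> //; case/norP: xu; rewrite eq_sym | right].
have no_old x y z : clash G c h u z ->
    [/\ clash G c h x y, x \notin [:: u; v] & y \notin [:: u; v]] -> False.
  move=> uz [/(meet _ _ _ uz)[<-|<-]]; rewrite ?inE ?eqxx //.
have same_end x y : x \in [:: u; v] -> y \in [:: u; v] ->
    porbit (mismatch c (swap u v h)) x = porbit (mismatch c (swap u v h)) y -> x = y.
  have /eqP := swap_separates neq uv; rewrite -/(swap u v _) -mismatch_swap => sep.
  by rewrite !inE => /orP[]/eqP-> /orP[]/eqP-> // /esym.
move=> pq ab; have [oldp|[w uw pqw]] := old_or_new _ _ pq.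
  have [olda|[w uw _]] := old_or_new _ _ ab; last by case: (no_old _ _ _ uw oldp).
  by case: oldp olda => [pq' _ _] [ab' _ _]; apply: one pq' ab'.
have [olda|[w' uw' abw]] := old_or_new _ _ ab; first by case: (no_old _ _ _ uw olda).
have {w' uw' abw} abw : a \in [:: u; v] /\ b = w \/ b \in [:: u; v] /\ a = w.
  suff -> : w = w' by [].
  by case: (at_most_one_clashP one uw uw') => [[_ ->]//|[<- ->]].
rewrite !inE; case: pq ab => _ opq _ _ [_ oab _ _].
case: pqw abw => -[e1 e2] [] [e3 e4]; subst; rewrite ?eqxx ?orbT //.
  by rewrite (same_end a p) ?eqxx // oab opq.
by rewrite (same_end a q) ?eqxx ?orbT // oab -opq.
Qed.

(** * Counting arcs of the graph *)

Lemma num_arcs_swap n (G : sgraph n) (h : 'S_n) u v : u != v ->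
  num_arcs G (swap u v h) + (G u (h u) + G v (h v)) =
  num_arcs G h + (G u (h v) + G v (h u)).
Proof.
move=> uv.
have numE k : num_arcs G k =
    G u (k u) + (G v (k v) + \sum_(x | (x != u) && (x != v)) G x (k x)).
  transitivity (\sum_x (G x (k x) : nat)).
    rewrite /num_arcs cardsE -sum1_card big_mkcond; apply: eq_bigr => x _.
    by rewrite unfold_in /arc_vertex; case: (G x _).
  by rewrite (bigD1 u) //= (bigD1 v) // eq_sym.
rewrite !numE swapL swapR.
have -> : \sum_(x | (x != u) && (x != v)) G x (swap u v h x) =
          \sum_(x | (x != u) && (x != v)) G x (h x).
  by apply: eq_bigr => x /andP[xu xv]; rewrite swap_id // !inE negb_or xu.
move: (\sum_(x | _) _) (G u (h u) : nat) (G v (h v) : nat) (G u (h v) : nat) => S; lia.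
Qed.

(** Here the new arc at [mismatch c h y] is an arc of c, hence counts 1. *)
Lemma num_arcs_align n (G : sgraph n) (c h : 'S_n) y :
    (forall x, arc_vertex G c x) -> mismatch c h y != y ->
  num_arcs G (swap (mismatch c h y) y h)
    + (arc_vertex G h (mismatch c h y) + arc_vertex G h y) =
  num_arcs G h + (1 + arc_vertex G (swap (mismatch c h y) y h) y).
Proof.
move=> Gc neq; rewrite num_arcs_swap // [in RHS]/arc_vertex swapR.
by rewrite -(mismatchE c h y) [G _ (c _)]Gc.
Qed.

Lemma clash_free_or n (G : sgraph n) (c h : 'S_n) :
  clash_free G c h \/ exists a b, clash G c h a b.
Proof.
pose clashb a b := [&& a != b, porbit (mismatch c h) a == porbit (mismatch c h) b,
  arc_vertex G h a & arc_vertex G h b].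
have [/existsP[a /existsP[b /and4P[ab /eqP oab Ga Gb]]]|none] :=
  boolP [exists a, exists b, clashb a b].
  by right; exists a, b.
left=> a b [ab oab Ga Gb]; case/negP: none; apply/existsP; exists a.
by apply/existsP; exists b; apply/and4P; split=> //; apply/eqP.
Qed.

(** A clash needs a cycle of length at least two, so agreements are never in one. *)
Lemma clash_moved n (G : sgraph n) (c h : 'S_n) a b :
  clash G c h a b -> mismatch c h a != a.
Proof.
by case=> ab oab _ _; apply: contraNneq ab => /porbit_fixed/(_ (esym oab)) ->.
Qed.

Lemma mismatch_align n (c h : 'S_n) y (x := mismatch c h y) :
  mismatch c (swap x y h) x = x.
Proof. by rewrite mismatch_swap swapL. Qed.

(** * The two exchanges of a step *)

(** Without a clash, the vertex y is chosen as the one vertex of its cycle with an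
arc of G, if there is one: then every clash after the exchange would be an old
one.  With a clash {p, q}, the choice y = p leaves two cases: the new arc at p is
outside G, and p no longer clashes while the new arc of c makes up for the loss;
or it is in G, and one arc of G is gained. *)
Lemma first_swap n (G : sgraph n) (c h : 'S_n) :
    (forall x, arc_vertex G c x) -> h <> c -> at_most_one_clash G c h ->
  exists2 y, mismatch c h y != y & let k := swap (mismatch c h y) y h in
    clash_free G c k /\ num_arcs G h <= num_arcs G k \/
    at_most_one_clash G c k /\ num_arcs G h < num_arcs G k.
Proof.
move=> Gc neq one; have [free|[p [q pq]]] := clash_free_or G c h.
  have [w mw] : exists w, mismatch c h w != w.
    apply/existsP; apply: contraT; rewrite negb_exists => /forallP fix_all.
    case: neq; apply/permP=> x; apply/eqP; rewrite -mismatch_fixed.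
    by have := fix_all x; rewrite negbK.
  have [y my lone] : exists2 y, mismatch c h y != y &
      forall b, b != y -> porbit (mismatch c h) b = porbit (mismatch c h) y ->
        ~~ arc_vertex G h b.
    have [/existsP[y /andP[/eqP oy Gy]]|none] :=
      boolP [exists y, (porbit (mismatch c h) y == porbit (mismatch c h) w)
                       && arc_vertex G h y].
      exists y; first exact: porbit_moved (esym oy) mw.
      by move=> b b_y ob; apply/negP=> Gb; apply: (free b y).
    exists w => // b _ ob; apply: contra none => Gb; apply/existsP; exists b.
    by rewrite ob eqxx.
  have oxy := porbit_step (mismatch c h) y.
  exists y => //=; set x := mismatch c h y in my oxy *; left; split.
    have none z : z \notin [:: x; y] ->
        porbit (mismatch c h) z = porbit (mismatch c h) x -> ~~ arc_vertex G h z.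
      by rewrite !inE negb_or => /andP[_ zy] oz; apply: lone; rewrite // oz.
    by move=> a b /(clash_swap_old oxy my none)[/free].
  have := num_arcs_align Gc my; rewrite -/x.
  have := lone x my oxy; case: (arc_vertex G h x) => // _.
  by case: (arc_vertex G h y) => /=; lia.
(* Up to exchanging p and q, either the vertex x that gains its arc of c is not
   the other end of the clash, or {p, q} is a whole cycle of length two, in which
   case both p and q come to agree with c. *)
have pq_sym := clash_sym pq.
wlog Dpq : p q pq pq_sym / mismatch c h p != q \/ mismatch c h q = p /\ mismatch c h p = q.
  move=> IH; have [Dpq|Dpq] := eqVneq (mismatch c h p) q; last by apply: (IH p q); auto.
  have [Dqp|Dqp] := eqVneq (mismatch c h q) p; first by apply: (IH p q); auto.
  by apply: (IH q p); auto.
exists p; first exact: clash_moved pq.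
have mp := clash_moved pq; have oxy := porbit_step (mismatch c h) p.
have gain := num_arcs_align Gc mp.
have [pneq opq Gp Gq] := pq.
set x := mismatch c h p in mp oxy gain Dpq *; set k := swap x p h in gain *.
have fixx a b : clash G c k a b -> a != x.
  move/clash_moved; apply: contraNneq => ->.
  by apply/eqP; apply: mismatch_align.
have rival z : z != p -> porbit (mismatch c h) z = porbit (mismatch c h) p ->
    arc_vertex G h z -> z = q.
  move=> zp oz Gz; have pz : clash G c h p z by split; rewrite // eq_sym.
  by case: (at_most_one_clashP one pq pz) => [[]|[pE]] //; rewrite pE eqxx in pneq.
have old a b : clash G c h a b -> a \notin [:: x; p] -> b \notin [:: x; p] -> False.
  by move=> /(at_most_one_clashP one pq)[[-> _ +]|[_ -> _]]; rewrite !inE eqxx orbT.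
case: Dpq => [xq|[Dqp Dpq]]; last first.
  have none w : w \notin [:: x; p] ->
      porbit (mismatch c h) w = porbit (mismatch c h) x -> ~~ arc_vertex G h w.
    rewrite !inE Dpq negb_or => /andP[wq wp] ow.
    by apply: contra wq => Gw; rewrite (rival w wp) // ow -Dpq.
  left; split; first by move=> a b /(clash_swap_old oxy mp none)[/old ab /ab].
  have kp : arc_vertex G k p.
    by rewrite /arc_vertex swapR Dpq -(mismatchE c h q) Dqp; apply: Gc.
  by move: gain; rewrite Dpq kp; case: (arc_vertex G h q); case: (arc_vertex G h p); rewrite /=; lia.
have Gx : ~~ arc_vertex G h x by apply: contra xq => Gx; rewrite (rival x mp).
have [kp|kp] := boolP (arc_vertex G k p); [right|left]; split.
- rewrite /k /swap tpermC; apply: at_most_one_clash_swap => //.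
  by rewrite eq_sym.
- by move: gain; rewrite (negPf Gx) kp Gp /=; lia.
- have no_end a b : clash G c k a b -> a \in [:: x; p] -> False.
    move=> kab; rewrite !inE (negPf (fixx _ _ kab)) => /eqP ap.
    by case: kab => _ _ + _; rewrite ap (negPf kp).
  move=> a b kab; case: (clash_swap oxy mp kab) => [[/old ab /ab]|[+ _ _ _]|[+ _ _ _]] //.
    exact: no_end kab.
  exact: no_end (clash_sym kab).
- by move: gain; rewrite (negPf Gx) (negPf kp) Gp /=; lia.
Qed.

(** As x and y do not clash, the arc of c gained at x covers the loss at y.  Since x
now agrees with c, a new clash must join y to a vertex of its old cycle with an
arc of G, and there is at most one such vertex. *)
Lemma second_swap_free n (G : sgraph n) (c h : 'S_n) y (x := mismatch c h y) :
    (forall x, arc_vertex G c x) -> clash_free G c h -> x != y ->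
  at_most_one_clash G c (swap x y h) /\ num_arcs G h <= num_arcs G (swap x y h).
Proof.
move=> Gc free my; have oxy : porbit (mismatch c h) x = porbit (mismatch c h) y.
  exact: porbit_step.
have gain := num_arcs_align Gc my; rewrite -/x in gain; split; last first.
  have : ~~ (arc_vertex G h x && arc_vertex G h y).
    by apply/negP=> /andP[Gx Gy]; apply: (free x y).
  by case: (arc_vertex G h x) gain; case: (arc_vertex G h y) => //=; lia.
have one_end a b : clash G c (swap x y h) a b -> exists2 w,
    porbit (mismatch c h) w = porbit (mismatch c h) x /\ arc_vertex G h w
    & a = y /\ b = w \/ b = y /\ a = w.
  have not_x e f : clash G c (swap x y h) e f -> e \in [:: x; y] -> e = y.
    move/clash_moved=> me; rewrite !inE => /orP[]/eqP ex //; case/eqP: me.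
    by rewrite ex; apply: mismatch_align.
  move=> kab; case: (clash_swap oxy my kab) => [[/free//]|[ae _ ob Gb]|[be _ oa Ga]].
    by exists b => //; left; split=> //; apply: not_x kab ae.
  by exists a => //; right; split=> //; apply: not_x (clash_sym kab) be.
move=> p q a b /one_end[w [ow Gw] pqw] /one_end[w' [ow' Gw'] abw'].
have ww : w = w'.
  by apply/eqP; apply: contraT => ww; case: (free w w'); split=> //; rewrite ow.
by case: pqw abw' => -[-> ->] [] [? ?]; subst; rewrite !inE eqxx ?orbT.
Qed.

(** If x or y has an arc of G, or if no vertex of their cycle has one, x and y
themselves are exchanged.  Otherwise a vertex g of the cycle with an arc of G is
exchanged with the one of x and y that lies on the other side. *)
Lemma second_swap n (G : sgraph n) (c h : 'S_n) y (x := mismatch c h y) :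
    (forall x, arc_vertex G c x) -> at_most_one_clash G c h ->
    porbit h x != porbit h y ->
  exists u v, [/\ porbit h u != porbit h v,
    porbit (mismatch c h) u = porbit (mismatch c h) v,
    mismatch c h u != u /\ mismatch c h v != v,
    at_most_one_clash G c (swap u v h) & num_arcs G h <= (num_arcs G (swap u v h)).+1].
Proof.
move=> Gc one sep; have xy : x != y by apply: contraNneq sep => ->.
have oxy : porbit (mismatch c h) x = porbit (mismatch c h) y by exact: porbit_step.
have my : mismatch c h y != y by [].
have gain := num_arcs_align Gc my; rewrite -/x in gain.
have mx := porbit_moved (esym oxy) my.
have [Gx|Gx] := boolP (arc_vertex G h x).
  exists x, y; split=> //; first exact: at_most_one_clash_swap.
  by move: gain; rewrite Gx; case: (arc_vertex G h y) => /=; lia.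
have [Gy|Gy] := boolP (arc_vertex G h y).
  exists x, y; split=> //; first by rewrite /swap tpermC; apply: at_most_one_clash_swap; rewrite // eq_sym.
  by move: gain; rewrite Gy (negPf Gx) /=; lia.
have [/existsP[g /andP[/eqP ogy Gg]]|none] :=
  boolP [exists g, (porbit (mismatch c h) g == porbit (mismatch c h) y)
                   && arc_vertex G h g]; last first.
  have none' w : w \notin [:: x; y] ->
      porbit (mismatch c h) w = porbit (mismatch c h) x -> ~~ arc_vertex G h w.
    move=> _ ow; apply: contra none => Gw; apply/existsP; exists w.
    by rewrite ow oxy eqxx.
  exists x, y; split=> //; last by move: gain; rewrite (negPf Gx) (negPf Gy) /=; lia.
  move=> p q a b /(clash_swap_old oxy xy none')[pq _ _].
  by move=> /(clash_swap_old oxy xy none')[ab _ _]; apply: one pq ab.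
have [w [sepg ogw mw Gw]] : exists w, [/\ porbit h g != porbit h w,
    porbit (mismatch c h) g = porbit (mismatch c h) w, mismatch c h w != w & ~~ arc_vertex G h w].
  have [ogx|ogx] := eqVneq (porbit h g) (porbit h x); last by exists x; rewrite ogy oxy.
  by exists y; rewrite ogx.
have gw : g != w by apply: contraNneq sepg => ->.
exists g, w; split=> //; first by rewrite (porbit_moved (esym ogw) mw).
  exact: at_most_one_clash_swap.
have := num_arcs_swap G h gw; move: Gg Gw; rewrite /arc_vertex => -> /negPf->.
by rewrite addn0 addn1 => ->; apply: leq_addr.
Qed.

(** * Paths of admissible permutations *)

Definition swap_step n (G : sgraph n) (h k : 'S_n) : Prop :=
  exists s, [/\ k = rcomp h s, admissible G h s & kcycle 3 s \/ two_disjoint_2cycles s].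

Definition agreement n (c h : 'S_n) : {set 'I_n} := [set x | h x == c x].

Lemma agreement_swap n (c h : 'S_n) u v :
    mismatch c h u != u -> mismatch c h v != v ->
  agreement c h \subset agreement c (swap u v h).
Proof.
rewrite !mismatch_fixed => mu mv; apply/subsetP=> x; rewrite !inE => hx.
rewrite swap_id // !inE negb_or; apply/andP; split; [move: mu|move: mv].
  by apply: contraNneq => <-.
by apply: contraNneq => <-.
Qed.

(** If c^-1 h preserved the cycles of h, then so would c. *)
Lemma crossing_vertex n (c h : 'S_n) (u v : 'I_n) :
    pseudo_hamilton_circuit c -> porbit h u != porbit h v ->
  exists y, porbit h (mismatch c h y) != porbit h y.
Proof.
move=> /pseudo_hamiltonP cP sep; apply/existsP; apply: contraT.
rewrite negb_exists => /forallP same; case/eqP: sep.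
apply: (@porbit_coarsen _ h c _ u v (cP u v)) => w.
have := same ((mismatch c h)^-1%g w); rewrite negbK permKV => /eqP->.
by rewrite -{1}[w](permKV (mismatch c h)) mismatchE porbit_step.
Qed.

(** The vertex x gains its arc of c in the first exchange and is then fixed by the
mismatch, so it is not touched by the second one; this makes the product of the
two transpositions a 3-cycle or a product of disjoint 2-cycles. *)
Lemma at_most_one_clash_step n (G : sgraph n) (c h : 'S_n) :
    hamilton_circuit G c -> pseudo_hamilton_circuit h -> at_most_one_clash G c h -> h <> c ->
  exists k, [/\ swap_step G h k, at_most_one_clash G c k & agreement c h \proper agreement c k].
Proof.
move=> [cP Gc] hP one neq; have [y my] := first_swap Gc neq one.
set x := mismatch c h y in my *; set h1 := swap x y h => /= first.
have card_h : #|porbits h| = 1 by apply/(hamilton_card _ x).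
have same w z : porbit h w = porbit h z by move/pseudo_hamiltonP: hP.
have card_h1 : #|porbits h1| = 2 by rewrite (porbits_split my) ?card_h.
have sep : porbit h1 x != porbit h1 y by apply: swap_separates.
have [y1 sep1] := crossing_vertex cP sep.
have one1 : at_most_one_clash G c h1 by case: first => -[] // /clash_free_one.
have [u [v [sep2 ouv mu mv [one2 gain]]]] : exists u v,
  [/\ porbit h1 u != porbit h1 v, porbit (mismatch c h1) u = porbit (mismatch c h1) v,
   mismatch c h1 u != u, mismatch c h1 v != v &
   at_most_one_clash G c (swap u v h1) /\ num_arcs G h <= num_arcs G (swap u v h1)].
  case: first => -[] => [free gain|_ gain].
    have m1 : mismatch c h1 y1 != y1 by apply: contraNneq sep1 => ->.
    have [one2 gain2] := second_swap_free Gc free m1.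
    exists (mismatch c h1 y1), y1; split=> //; first exact: porbit_step.
      by apply: porbit_moved m1; rewrite porbit_step.
    by split=> //; apply: leq_trans gain gain2.
  have [u [v [? ? [? ?] ? gain2]]] := second_swap Gc one1 sep1.
  exists u, v; split=> //; split=> //; lia.
have uv : u != v by apply: contraNneq sep2 => ->.
have fixx : mismatch c h1 x = x by apply: mismatch_align.
have xu : x != u by apply: contraNneq mu => <-; rewrite fixx.
have xv : x != v by apply: contraNneq mv => <-; rewrite fixx.
exists (swap u v h1); split=> //.
  exists (tperm u v * tperm x y)%g; split; last exact: tpermM_shape.
    by rewrite /rcomp /h1 /swap mulgA.
  rewrite /admissible /rcomp -mulgA -/(swap x y h) -/h1 -/(swap u v h1); split=> //.
  apply/(hamilton_card _ x); have := porbits_merge sep2.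
  by rewrite card_h1 => -[<-].
have mx : mismatch c h x != x by apply: porbit_moved my; rewrite porbit_step.
have sub2 := agreement_swap mu mv.
rewrite properE (subset_trans (agreement_swap mx my) sub2) /=.
apply/subsetPn; exists x; last by rewrite inE -mismatch_fixed.
by apply: (subsetP sub2); rewrite inE -mismatch_fixed fixx.
Qed.

(** By induction on the number of vertices at which h and c disagree. *)
Lemma admissible_path n (G : sgraph n) (c h : 'S_n) :
    hamilton_circuit G c -> pseudo_hamilton_circuit h -> at_most_one_clash G c h ->
  exists (r : nat) (H : nat -> 'S_n),
    [/\ H 0 = h, H r = c & forall i, i < r -> swap_step G (H i) (H i.+1)].
Proof.
move=> hc; have [m] := ubnP #|~: agreement c h|; elim: m => // m IHm in h *.
rewrite ltnS => hm hP one; have [-> | /eqP neq] := eqVneq h c.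
  by exists 0, (fun=> c).
have [k [step one_k agr]] := at_most_one_clash_step hc hP one neq.
have kP : pseudo_hamilton_circuit k by case: step => s [-> [+ _] _].
have km : #|~: agreement c k| < m.
  by apply: leq_trans hm; rewrite proper_card // properC.
have [r [H [H0 Hr Hstep]]] := IHm k km kP one_k.
by exists r.+1, (fun i => if i is j.+1 then H j else h); split=> // -[|i] /=; rewrite ?H0 //; apply: Hstep.
Qed.

Theorem theorem1p10 (n : nat) (G : sgraph n) (HC H0 : 'S_n)
    (hHC : hamilton_circuit G HC)
    (hH0 : pseudo_hamilton_circuit H0)
    (hH0G : forall x : 'I_n, pseudo_arc_vertex G H0 x) :
  exists (r : nat) (s H : nat -> 'S_n),
    [/\ H 0 = H0,
        H r = HC &
        forall i : nat, i < r ->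
          [/\ H i.+1 = rcomp (H i) (s i),
              admissible G (H i) (s i) &
              kcycle 3 (s i) \/ two_disjoint_2cycles (s i)]].
Proof.
have one : at_most_one_clash G HC H0 by move=> p q a b [_ _ Gp]; case/negP: (hH0G p).
have [r [H [H_0 H_r step]]] := admissible_path hHC hH0 one.
exists r, (fun i => H i.+1 * (H i)^-1)%g, H; split=> // i /step[s [Hi adm shape]].
by rewrite Hi /rcomp mulgK.
Qed.
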